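(* Let $C\subset\mathbb{R}^{n+1}$ be an unbounded convex body with non-degenerate asymptotic cone $C_\infty$. Assume that $0$ is a vertex of $C_\infty$ and that $\partial C_\infty\setminus\{0\}$ is of class $C^1$. Then any asymptotic cylinder $K\in\mathcal{K}(C)$ is either $\mathbb{R}^{n+1}$ or a half-space.
   Context: Here $n\ge1$. A convex body is a closed convex subset of $\mathbb{R}^{n+1}$ with non-empty interior. The asymptotic cone of $C$ is $C_\infty=\bigcap_{\lambda>0}\lambda(C-p)$ for any $p\in C$ (independent of $p$; equal to $\bigcap_{\lambda>0}\lambda C$ if $0\in C$); it is non-degenerate if it has non-empty interior. A sequence $C_i$ of closed convex sets converges locally in Hausdorff distance to a closed convex set $K$ if, for every open ball $B$ with $K\cap B\ne\emptyset$, $C_i\cap\overline{B}$ converges to $K\cap\overline{B}$ in Hausdorff distance. $\mathcal{K}(C)$ is the set of asymptotic cylinders of $C$: all local Hausdorff limits of sequences $-x_i+C$ with $x_i\in C$, $|x_i|\to\infty$. *)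

(* Defs.v *)
From HB Require Import structures.
From mathcomp Require Import all_boot all_order all_algebra.
From mathcomp Require Import all_classical all_reals all_analysis.

Set Implicit Arguments.
Unset Strict Implicit.
Unset Printing Implicit Defensive.

Import Order.TTheory GRing.Theory Num.Theory.
Import numFieldNormedType.Exports.

Local Open Scope classical_set_scope.
Local Open Scope ring_scope.

(** The library's norm on ['rV[R]_m] is the sup norm. It induces the usual
    topology, so [closed], [closure], interior, [bounded_set] and
    differentiability are the library's; wherever a metric occurs explicitly
    (balls, Hausdorff distance, [|x_i|]) the Euclidean norm [enorm] is used. *)

Section Euclidean.
Context {R : realType} {m : nat}.
Implicit Types (u x y c p : 'rV[R]_m) (A B : set 'rV[R]_m).

Definition dot u x : R := \sum_(j < m) u 0 j * x 0 j.

Definition enorm x : R := Num.sqrt (dot x x).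

Definition eball c (r : R) : set 'rV[R]_m := [set x | enorm (x - c) < r].

Definition translate x A : set 'rV[R]_m := [set x + y | y in A].

Definition dilate (l : R) A : set 'rV[R]_m := [set l *: y | y in A].

Definition frontier A : set 'rV[R]_m := closure A `\` A°.

Definition closed_half_space A : Prop :=
  exists u (c : R), u != 0 /\ A = [set x | dot u x <= c].

End Euclidean.

Section Convex.
Context {R : realType} {m : nat}.
Implicit Types (p : 'rV[R]_m) (A C : set 'rV[R]_m).

Definition convex_body C : Prop :=
  [/\ closed C, convex_set C & C° !=set0].

(** For closed convex [C] this does not depend on the choice of [p \in C]. *)
Definition asymptotic_cone C p : set 'rV[R]_m :=
  \bigcap_(l in [set l : R | 0 < l]) dilate l (translate (- p) C).

Definition nondegenerate_cone A : Prop := A° !=set0.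

Definition normal_cone A p : set 'rV[R]_m :=
  [set u | forall x, A x -> dot u (x - p) <= 0].

(** A vertex of a convex set is a point whose normal cone is full-dimensional;
    a convex cone in R^m has dimension m iff its interior is non-empty. *)
Definition is_vertex A p : Prop := A p /\ (normal_cone A p)° !=set0.

End Convex.

Section Smooth.
Context {R : realType} {m : nat}.

(** In finite dimension, continuity of ['d f y v] in [y] for each fixed [v] is
    continuity of the differential. *)
Definition C1_on (U : set 'rV[R]_m) (f : 'rV[R]_m -> R) : Prop :=
  forall y, U y ->
    differentiable f y /\
    forall v : 'rV[R]_m, {for y, continuous (fun z => 'd f z v)}.

(** An (embedded) hypersurface of class C^1: locally the zero set of a C^1
    function with non-vanishing differential. *)
Definition C1_hypersurface (S : set 'rV[R]_m) : Prop :=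
  forall p, S p ->
    exists (U : set 'rV[R]_m) (f : 'rV[R]_m -> R),
      [/\ open U, U p, C1_on U f,
          forall y, U y -> exists v, 'd f y v != 0 &
          S `&` U = [set y | f y = 0] `&` U].

End Smooth.

Section Hausdorff.
Context {R : realType} {m : nat}.
Implicit Types (A B C K : set 'rV[R]_m).

(** The parallel set [A + r B(0,1)], with the closed unit ball. *)
Definition parallel_set A (r : R) : set 'rV[R]_m :=
  [set x | exists2 y, A y & enorm (x - y) <= r].

(** Extended-real valued; it is [+oo] between the empty set and a non-empty
    set. *)
Definition hausdorff_dist A B : \bar R :=
  ereal_inf [set r%:E | r in
    [set r : R | [/\ 0 <= r, A `<=` parallel_set B r &
                     B `<=` parallel_set A r]]].

Definition local_hausdorff_cvg (A : nat -> set 'rV[R]_m) K : Prop :=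
  forall (c : 'rV[R]_m) (r : R), K `&` eball c r !=set0 ->
    hausdorff_dist (A i `&` closure (eball c r)) (K `&` closure (eball c r))
      @[i --> \oo] --> 0%E.

(** Limits are required to be non-empty: [local_hausdorff_cvg A set0] holds
    vacuously. *)
Definition asymptotic_cylinder C K : Prop :=
  [/\ closed K, convex_set K, K !=set0 &
      exists x : nat -> 'rV[R]_m,
        [/\ forall i, C (x i),
            enorm (x i) @[i --> \oo] --> +oo%R &
            local_hausdorff_cvg (fun i => translate (- x i) C) K]].

End Hausdorff.

(* Main.v *)
Require Import Defs.
From mathcomp Require Import all_boot all_order all_algebra.
From mathcomp Require Import all_classical all_reals all_analysis.
From mathcomp Require Import ring lra.
Import Order.TTheory GRing.Theory Num.Theory.
Import numFieldNormedType.Exports.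
Local Open Scope classical_set_scope.
Local Open Scope ring_scope.

(** Write V for the asymptotic cone and let d be a limit point of x_i / |x_i|;
    then d is in V. Since V is a recession cone, V is contained in every C - x_i,
    hence in K; and since C - x_i contains the segment from 0 to p - x_i, the ray
    -R_+ d lies in K as well. Therefore V - R_+ d is contained in K. If d is
    interior to V, this set is the whole space. Otherwise d is a nonzero boundary
    point, near which the boundary is the zero set of some f; the intermediate
    value theorem yields zeros of f, that is points of V, arbitrarily close in
    direction to any tangent vector at d, so that K contains the kernel of df_d.
    Adding a point of V outside this kernel gives a closed half-space inside K,
    and a closed convex set containing a half-space is the whole space or a
    half-space. *)

Set Implicit Arguments.
Unset Strict Implicit.

(** * Comparison of the sup norm and the Euclidean norm *)

Lemma coord_le_norm (R : realType) (m : nat) (x : 'rV[R]_m) (j : 'I_m) :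
  `|x 0 j| <= `|x|.
Proof.
by rewrite [leRHS]/Num.Def.normr/= mx_normrE; apply/bigmax_geP; right; exists (0, j).
Qed.

Lemma norm_le_enorm (R : realType) (m : nat) (x : 'rV[R]_m) : `|x| <= enorm x.
Proof.
rewrite [leLHS]/Num.Def.normr/= mx_normrE; apply/bigmax_leP; split=> [|[i j] _ /=].
  exact: sqrtr_ge0.
rewrite (ord1 i) -sqrtr_sqr ler_wsqrtr// /dot (bigD1 j)//= expr2 lerDl.
by apply: sumr_ge0 => k _; rewrite -expr2 sqr_ge0.
Qed.

Lemma enorm_le_norm (R : realType) (m : nat) (x : 'rV[R]_m) :
  enorm x <= Num.sqrt m%:R * `|x|.
Proof.
rewrite -[`|x|]ger0_norm// -sqrtr_sqr -sqrtrM// ler_wsqrtr// /dot.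
rewrite (_ : _ * _ = \sum_(j < m) `|x| ^+ 2); last first.
  by rewrite sumr_const card_ord mulr_natl.
apply: ler_sum => j _; rewrite -expr2 -real_normK ?num_real//.
by rewrite lerXn2r ?nnegrE ?coord_le_norm.
Qed.

(** * Signs and zeros of a differentiable function near one of its zeros *)

Lemma diff_sign_near (R : realType) (V : normedModType R) (f : V -> R) (d v : V) :
  differentiable f d -> f d = 0 -> 'd f d v != 0 ->
  \forall e \near 0^'+, 0 < 'd f d v * f (d + e *: v).
Proof.
move=> fd fd0 dv.
have fdv : h^-1 *: ((f \o shift d) (h *: v) - f d) @[h --> 0^'] --> 'd f d v.
  by rewrite -deriveE//; exact: diff_derivable.
(* The difference quotient times ['d f d v] tends to this square. *)
have pos : 0 < 'd f d v * 'd f d v by rewrite -expr2 exprn_even_gt0.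
have : \forall h \near 0^'+, 0 < 'd f d v * (h^-1 *: ((f \o shift d) (h *: v) - f d)).
  exact: cvgr_gt (cvgMl_tmp (cvg_dnbhs_at_right fdv)) _ pos.
move=> h1; near=> h.
have hp : 0 < h by near: h; exact: nbhs_right_gt.
have : 0 < 'd f d v * (h^-1 *: ((f \o shift d) (h *: v) - f d)) by near: h.
by rewrite /= fd0 subr0 mulrCA pmulr_rgt0 ?invr_gt0// addrC.
Unshelve. all: by end_near. Qed.

(** Tilting the tangent vector [h] by [delta *: w] and by [- delta *: w] gives derivatives of
    opposite signs. Once [e] is small, [f] has opposite signs at the two ends of the segment over
    [s] in [[- delta, delta]], and the intermediate value theorem in [s] applies. *)
Lemma diff_zero_near_tangent (R : realType) (V : normedModType R)
    (f : V -> R) (U : set V) (d w h : V) (delta : R) :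
  open U -> U d -> (forall y, U y -> {for y, continuous f}) ->
  differentiable f d -> f d = 0 -> 'd f d w != 0 -> 'd f d h = 0 -> 0 < delta ->
  exists e s : R, [/\ 0 < e, `|s| <= delta, U (d + e *: (h + s *: w)) &
     f (d + e *: (h + s *: w)) = 0].
Proof.
move=> Uo Ud fc fd fd0 dw dh delta0.
have [r /= r0 rU] : exists2 r : R, 0 < r & forall y, `|d - y| < r -> U y.
  have /nbhs_ballP[r r0 rU] := open_nbhs_nbhs (conj Uo Ud).
  by exists r => // y dy; apply: rU; rewrite -ball_normE.
have dlin s : 'd f d (h + s *: w) = s * 'd f d w.
  by rewrite linearD linearZ dh add0r.
have dneq s : s != 0 -> 'd f d (h + s *: w) != 0.
  by move=> s0; rewrite dlin mulf_neq0.
(* A positive bound for [h + s *: w] over all admissible [s], so that [e < r / B] keeps the whole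
   segment inside [U]. *)
pose B := `|h| + delta * `|w| + 1.
have B0 : 0 < B by rewrite ltr_wpDl// addr_ge0// mulr_ge0// ltW.
near ((0 : R)^'+) => e.
have e0 : 0 < e by near: e; exact: nbhs_right_gt.
have eB : e < r / B by near: e; apply: nbhs_right_lt; rewrite divr_gt0.
pose g s := f (d + e *: (h + s *: w)).
have gU s : `|s| <= delta -> U (d + e *: (h + s *: w)).
  move=> sd; apply: rU; rewrite opprD addNKr normrN normrZ gtr0_norm//.
  move: eB; rewrite ltr_pdivlMr//; apply: le_lt_trans; rewrite ler_pM2l//.
  apply: le_trans (ler_normD _ _) _; rewrite normrZ /B -addrA lerD2l.
  by rewrite ler_wpDr// ler_wpM2r.
have gpos : 0 < 'd f d (h + delta *: w) * g delta.
  by rewrite /g; near: e; apply: diff_sign_near => //; rewrite dneq// gt_eqF.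
have gneg : 0 < 'd f d (h + (- delta) *: w) * g (- delta).
  by rewrite /g; near: e; apply: diff_sign_near => //; rewrite dneq// oppr_eq0 gt_eqF.
move: gpos gneg; rewrite !dlin mulNr mulNr oppr_gt0 -!mulrA pmulr_rgt0// pmulr_rlt0//.
move=> gpos gneg.
have [|||s sI gs] := @IVT R g (- delta) delta 0.
- by rewrite ge0_cp// ltW.
- apply: continuous_in_subspaceT => s; rewrite inE/= => sI.
  apply: (@continuous_comp _ _ _ (fun s : R => d + e *: (h + s *: w)) f).
    apply: cvgD (cvg_cst _) (cvgZl_tmp (cvgD (cvg_cst _) (cvgZr_tmp cvg_id))).
  by apply: fc; apply: gU; rewrite ler_norml; move: sI; rewrite in_itv.
- move: dw gpos gneg; rewrite neq_lt => /orP[] dw0.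
    by rewrite nmulr_rgt0// nmulr_rlt0// => a b; rewrite ge_min le_max (ltW a) (ltW b) ?orbT.
  by rewrite pmulr_rgt0// pmulr_rlt0// => a b; rewrite ge_min le_max (ltW a) (ltW b) ?orbT.
have sd : `|s| <= delta by rewrite ler_norml; move: sI; rewrite in_itv.
by exists e, s; split=> //; exact: gU.
Unshelve. all: by end_near. Qed.

(** * Closed convex sets and local Hausdorff limits *)

Section EuclideanSpace.
Context {R : realType} {m : nat}.
Implicit Types (A V C K : set 'rV[R]_m) (u w x y v d p : 'rV[R]_m).

Lemma closed_approx A x : closed A ->
  (forall e : R, 0 < e -> exists2 y, A y & `|x - y| < e) -> A x.
Proof.
move=> Acl Ax; apply: Acl => B /nbhs_ballP[e e0 eB].
have [y Ay xy] := Ax e e0; exists y; split=> //; apply: eB.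
by rewrite -ball_normE.
Qed.

Lemma convex_set_comb {A x y} {t : R} : convex_set (A : set (convex_lmodType _)) ->
  A x -> A y -> 0 <= t <= 1 -> A (t *: x + (1 - t) *: y).
Proof.
move=> Acvx Ax Ay /andP[t0 t1].
by have := Acvx x y (Itv01 t0 t1) (mem_set Ax) (mem_set Ay); rewrite inE.
Qed.

Lemma convex_set_mid {A x y} : convex_set (A : set (convex_lmodType _)) ->
  A (2 *: x) -> A (2 *: y) -> A (x + y).
Proof.
move=> Acvx Ax Ay; have h01 : 0 <= (2^-1 : R) <= 1 by lra.
have := convex_set_comb Acvx Ax Ay h01; rewrite !scalerA mulVf// scale1r.
by rewrite (_ : (1 - 2^-1) * 2 = 1 :> R) ?scale1r//; field.
Qed.

(** How points are shown to lie in a cylinder: it is enough to approximate them by points of [S i]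
    for arbitrarily large [i]. *)
Lemma local_hausdorff_limit (S : nat -> set 'rV[R]_m) K y :
  closed K -> K !=set0 -> local_hausdorff_cvg S K ->
  (forall e : R, 0 < e -> forall N, exists i z,
     [/\ (N <= i)%N, S i z & `|y - z| < e]) -> K y.
Proof.
move=> Kcl [k0 Kk0] SK Sy.
(* Large enough for the ball around [y] to meet [K], as local convergence requires. *)
pose r := enorm (k0 - y) + 1.
have r0 : 0 < r by rewrite ltr_wpDl// sqrtr_ge0.
have /SK : K `&` eball y r !=set0 by exists k0; split=> //; rewrite /eball/= ltrDl.
move=> SKr; apply: closed_approx => // e e0.
have e20 : 0 < e / 2 by rewrite divr_gt0.
have : \forall i \near \oo, (hausdorff_dist (S i `&` closure (eball y r))
   (K `&` closure (eball y r)) < (e / 2)%:E)%E.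
  by apply: (SKr [set u | (u < (e / 2)%:E)%E]); apply: open_ereal_lt'; rewrite lte_fin.
move=> [N _ NS].
(* A sup-norm radius whose ball around [y] lies in the Euclidean ball of radius [r]; it brings [z]
   into the window where the distance is measured. *)
pose q := r / (Num.sqrt m%:R + 1).
have q0 : 0 < q by rewrite divr_gt0// ltr_wpDl// sqrtr_ge0.
have eq0 : 0 < Num.min (e / 2) q by rewrite lt_min e20.
have [i [z [Ni Siz]]] := Sy _ eq0 N.
rewrite lt_min => /andP[yze yzq].
have /ereal_inf_lt[_ [s [s0 + _] <-]] := NS i Ni.
rewrite lte_fin => SsK se.
have [] := SsK z.
  split=> //; apply: subset_closure; rewrite /eball/=.
  apply: le_lt_trans (enorm_le_norm _) _.
  rewrite distrC; apply: (@le_lt_trans _ _ (Num.sqrt m%:R * q)).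
    by rewrite ler_wpM2l// ?sqrtr_ge0// ltW.
  have M0 : 0 <= Num.sqrt m%:R :> R by rewrite sqrtr_ge0.
  rewrite /q mulrA ltr_pdivrMr ?ltr_wpDl// mulrC ltr_pM2l//; lra.
move=> k [Kk _] zk; exists k => //.
rewrite -(subrKA z) (splitr e); apply: le_lt_trans (ler_normD _ _) _.
by rewrite ltrD// (le_lt_trans _ se)// (le_trans _ zk)// norm_le_enorm.
Qed.


(** * Asymptotic cones and directions at infinity *)

Lemma asymptotic_coneE C p :
  asymptotic_cone C p = [set v | forall l : R, 0 < l -> C (p + l *: v)].
Proof.
apply/seteqP; split=> v Cv l l0 /=.
  have /Cv[_ [x Cx <-] <-] : 0 < l^-1 by rewrite invr_gt0.
  by rewrite scalerA divff ?gt_eqF// scale1r addNKr.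
exists (l^-1 *: v); last by rewrite scalerA divff ?gt_eqF// scale1r.
exists (p + l^-1 *: v); first by apply: Cv; rewrite invr_gt0.
by rewrite addKr.
Qed.

Lemma asymptotic_coneZ C p v (a : R) :
  0 < a -> asymptotic_cone C p v -> asymptotic_cone C p (a *: v).
Proof.
rewrite asymptotic_coneE => a0 Cv l l0; rewrite scalerA.
by apply: Cv; rewrite mulr_gt0.
Qed.

Lemma closed_asymptotic_cone C p : closed C -> closed (asymptotic_cone C p).
Proof.
move=> Ccl; rewrite asymptotic_coneE (_ : [set _ | _] =
  \bigcap_(l in [set l : R | 0 < l]) ((fun v => p + l *: v) @^-1` C))//.
apply: closed_bigI => l _.
have cf : continuous (fun v => p + l *: v).
  by move=> v; exact: cvgD (cvg_cst _) (cvgZl_tmp cvg_id).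
exact: (preimage_closed (fun v _ => cf v) Ccl).
Qed.

(** Join [x] to the far point [p + t^-1 *: v] of the ray from [p]: the convex combination with
    weight [t] is [x + v + t *: (p - x)], which tends to [x + v] as [t] tends to 0. *)
Lemma asymptotic_cone_recession C p x v : closed C -> convex_set C ->
  asymptotic_cone C p v -> C x -> C (x + v).
Proof.
rewrite asymptotic_coneE => Ccl Ccvx Cv Cx.
apply: closed_approx => // e e0.
have D0 : 0 < `|x - p| + e by rewrite ltr_wpDl.
pose t := e / (`|x - p| + e).
have t0 : 0 < t by rewrite divr_gt0.
have t01 : 0 <= t <= 1 by rewrite (ltW t0)/= ler_pdivrMr// mul1r lerDr.
have Cq : C (p + t^-1 *: v) by apply: Cv; rewrite invr_gt0.
exists (t *: (p + t^-1 *: v) + (1 - t) *: x); first exact: convex_set_comb Ccvx Cq Cx t01.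
rewrite (_ : _ - _ = t *: (x - p)).
  by rewrite normrZ gtr0_norm// mulrAC ltr_pdivrMr// ltr_pM2l// ltrDl.
rewrite scalerDr scalerA divff ?gt_eqF// scale1r scalerBl scale1r scalerBr.
by apply/rowP => j; rewrite !mxE; ring.
Qed.

(** Here [d] is a cluster point of the normalised sequence. The base point [p] is harmless since
    [(t / |x i|) *: p] tends to 0, and [|t| < |x i|] will make [t / |x i|] a convex weight when [t]
    is positive. *)
Lemma sphere_cluster (x : nat -> 'rV[R]_m) p :
  enorm (x i) @[i --> \oo] --> +oo ->
  exists2 d, d != 0 & forall t e : R, 0 < e -> forall N, exists i,
    [/\ (N <= i)%N, `|t| < `|x i| &
        `|t *: d - (t / `|x i|) *: (x i - p)| < e].
Proof.
move=> xoo.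
have nxoo (A : R) : \forall i \near \oo, A < `|x i|.
  near=> i.
  have : Num.sqrt m%:R * A < enorm (x i) by near: i; exact: cvgry_gt.
  move=> /lt_le_trans /(_ (enorm_le_norm _)) h; rewrite ltNge; apply/negP => xA.
  by move: h; rewrite ltNge ler_wpM2l ?sqrtr_ge0.
pose u i := `|x i|^-1 *: x i.
pose sphere := [set y : 'rV[R]_m | `|y| = 1].
have sphere_compact : compact sphere.
  apply: bounded_closed_compact.
    by exists 1; split=> // M M1 y /= ->; exact: ltW.
  rewrite (_ : sphere = Num.Def.normr @^-1` [set 1])//.
  exact: (preimage_closed (fun y _ => @norm_continuous _ _ y) (@closed_eq _ _)).
have u1 : \forall i \near \oo, sphere (u i).
  near=> i; have xi0 : 0 < `|x i| by near: i.
  by rewrite /sphere/= normrZ normfV normr_id mulVf ?gt_eqF.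
have [d [d1 ud]] := sphere_compact (u @ \oo) _ u1.
exists d; first by rewrite -normr_gt0 d1.
move=> t e e0 N.
pose r := e / 2 / (`|t| + 1).
have r0 : 0 < r by rewrite !divr_gt0// ltr_wpDl.
(* Beyond the second bound, the term in [p] contributes less than [e / 2]. *)
pose M := Num.max `|t| (`|t * 2| * `|p| / e).
have tail : \forall i \near \oo,
    [set u i | i in [set i | (N <= i)%N /\ M < `|x i|]] (u i).
  near=> i; exists i => //=; split; near: i => //; exact: nbhs_infty_ge.
have := ud _ _ tail (nbhsx_ballx d r r0).
move=> [_ [[i [Ni +] <-] +]]; rewrite -ball_normE/= gt_max => /andP[ti pi] dui.
exists i; split=> //.
have xi0 : 0 < `|x i| by exact: le_lt_trans ti.
rewrite (_ : _ - _ = t *: (d - u i) + (t / `|x i|) *: p); last first.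
  by apply/rowP => j; rewrite !mxE; ring.
apply: le_lt_trans (ler_normD _ _) _; rewrite (splitr e) ltrD//.
  rewrite normrZ; apply: (@le_lt_trans _ _ (`|t| * r)).
    by rewrite ler_wpM2l// ltW.
  rewrite /r mulrA ltr_pdivrMr ?ltr_wpDl// mulrC ltr_pM2l ?divr_gt0//; lra.
rewrite normrZ normrM normfV normr_id mulrAC ltr_pdivrMr//.
move: pi; rewrite normrM ltr_pdivrMr// (ger0_norm (_ : 0 <= 2))//; lra.
Unshelve. all: by end_near. Qed.

(** * Linear functionals and half-spaces *)

Lemma dotDr u x y : dot u (x + y) = dot u x + dot u y.
Proof. by rewrite /dot -big_split; apply: eq_bigr => j _; rewrite mxE mulrDr. Qed.

Lemma dotZr u (a : R) x : dot u (a *: x) = a * dot u x.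
Proof. by rewrite /dot mulr_sumr; apply: eq_bigr => j _; rewrite mxE mulrCA. Qed.

Lemma dot_gt0 u : u != 0 -> 0 < dot u u.
Proof.
move=> u0; rewrite lt_neqAle eq_sym; apply/andP; split.
  apply: contra u0; rewrite psumr_eq0; last first.
    by move=> j _; rewrite -expr2 sqr_ge0.
  move=> /allP uj; apply/eqP/rowP => j; rewrite mxE.
  by apply/eqP; rewrite -[_ == 0]orbb -mulf_eq0; apply: uj; rewrite mem_index_enum.
by apply: sumr_ge0 => j _; rewrite -expr2 sqr_ge0.
Qed.

Lemma half_space_sup K u : u != 0 -> closed K -> convex_set K ->
  (forall x, dot u x <= 0 -> K x) -> K = setT \/ closed_half_space K.
Proof.
move=> u0 Kcl Kcvx uK; have uu := dot_gt0 u0.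
(* For [dot u w] positive, [w] lies on a segment from [k] to a point of the hyperplane
   [dot u y = 0]; the weight [t] is the one that makes [dot u y] vanish. *)
have ltK w k : K k -> dot u w < dot u k -> K w.
  move=> Kk wk; have [|w0] := lerP (dot u w) 0; first exact: uK.
  have k0 : 0 < dot u k := lt_trans w0 wk.
  pose t := dot u w / dot u k.
  have t1 : t < 1 by rewrite ltr_pdivrMr// mul1r.
  have t01 : 0 <= t <= 1 by rewrite (ltW t1) andbT divr_ge0// ltW.
  have s0 : 1 - t != 0 by rewrite subr_eq0 gt_eqF.
  have Ky : K ((1 - t)^-1 *: (w + (- t) *: k)).
    apply: uK; rewrite dotZr dotDr dotZr mulNr /t divfK ?gt_eqF// subrr.
    by rewrite mulr0.
  have := convex_set_comb Kcvx Kk Ky t01.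
  by rewrite scalerA divff// scale1r scaleNr addrC subrK.
have Kne : (dot u @` K) !=set0.
  by exists (dot u 0), 0 => //; apply: uK; rewrite -(scale0r 0) dotZr mul0r.
have [ubK|nubK] := pselect (has_ubound (dot u @` K)).
  right; exists u, (sup (dot u @` K)); split=> //.
  apply/seteqP; split=> w /= Kw; first by apply: ub_le_sup => //; exists w.
  apply: closed_approx => // e e0.
  (* Moving [w] by [- t *: u] costs less than [e] and brings its value strictly below the supremum,
     where [ltK] applies. *)
  pose t := e / (`|u| + 1).
  have t0 : 0 < t by rewrite divr_gt0// ltr_wpDl.
  have lt_sup : dot u (w + (- t) *: u) < sup (dot u @` K).
    by rewrite dotDr dotZr mulNr; apply: lt_le_trans Kw; rewrite gtrDl oppr_lt0 mulr_gt0.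
  exists (w + (- t) *: u).
    by have [_ [k Kk <-]] := sup_gt Kne lt_sup; exact: ltK.
  rewrite opprD addNKr scaleNr opprK normrZ gtr0_norm// /t mulrAC.
  by rewrite ltr_pdivrMr ?ltr_wpDl// ltr_pM2l// ltrDl.
left; apply/seteqP; split=> // w _.
have [[_ [k Kk <-] wk]|h] := pselect (exists2 y, (dot u @` K) y & dot u w < y).
  exact: ltK wk.
exfalso; apply: nubK; exists (dot u w) => y Ky; rewrite leNgt; apply/negP => wy.
by apply: h; exists y.
Qed.

Lemma linear_dot (g : {linear 'rV[R]_m -> R}) x :
  g x = dot (\row_j g (delta_mx 0 j)) x.
Proof.
rewrite {1}(row_sum_delta x) linear_sum; apply: eq_bigr => j _.
by rewrite linearZ mxE mulrC.
Qed.

Lemma asymptotic_cylinder_cone C K p : closed C -> convex_set C -> C p ->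
  asymptotic_cylinder C K ->
  exists d, [/\ asymptotic_cone C p d, d != 0, asymptotic_cone C p `<=` K &
    forall t : R, 0 < t -> K (- (t *: d))].
Proof.
move=> Ccl Ccvx Cp [Kcl Kcvx Kne [x [Cx xoo CK]]].
have [d d0 xd] := sphere_cluster p xoo.
have ratio (t : R) i : 0 < t -> `|t| < `|x i| -> 0 <= t / `|x i| <= 1.
  move=> t0 txi; have xi0 : 0 < `|x i| by exact: le_lt_trans txi.
  by rewrite (divr_ge0 (ltW t0) (ltW xi0))/= ler_pdivrMr// mul1r -(gtr0_norm t0) ltW.
exists d; split=> //.
- rewrite asymptotic_coneE => l l0; apply: closed_approx => // e e0.
  have [i [_ li xie]] := xd l e e0 0%N.
  exists (p + (l / `|x i|) *: (x i - p)); last by rewrite opprD addrACA subrr add0r.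
  (* The approximating point lies on the segment from [p] to [x i], hence in [C]. *)
  rewrite (_ : _ + _ = (l / `|x i|) *: x i + (1 - l / `|x i|) *: p).
    exact: convex_set_comb (ratio _ _ l0 li).
  by apply/rowP => j; rewrite !mxE; ring.
- move=> v Cv; apply: local_hausdorff_limit CK _ => // e e0 N.
  exists N, v; split=> //; last by rewrite subrr normr0.
  by exists (x N + v); rewrite ?addKr//; exact: asymptotic_cone_recession Cv _.
- move=> t t0; apply: local_hausdorff_limit CK _ => // e e0 N.
  have [i [Ni ti xie]] := xd t e e0 N.
  exists i, (- ((t / `|x i|) *: (x i - p))); split=> //; last first.
    by rewrite -opprD normrN.
  exists ((t / `|x i|) *: p + (1 - t / `|x i|) *: x i).
    exact: convex_set_comb (ratio _ _ t0 ti).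
  by apply/rowP => j; rewrite !mxE; ring.
Qed.

(** * From a smooth boundary direction to a half-space *)

Lemma interior_segment A d w : A° d -> exists2 e : R, 0 < e & A (d + e *: w).
Proof.
move=> /nbhs_ballP[r /= r0 rA].
have D0 : 0 < `|w| + 1 by rewrite ltr_wpDl.
exists (r / (`|w| + 1)); first by rewrite divr_gt0.
apply: rA; rewrite -ball_normE/= opprD addNKr normrN normrZ.
by rewrite gtr0_norm ?divr_gt0// mulrAC ltr_pdivrMr// ltr_pM2l// ltrDl.
Qed.

(** The hypothesis on [d + e *: w] puts every direction pointing from [d] into [V] in [K];
    closedness of [K] then adds the limits of such directions, in particular the tangent ones. *)
Lemma tangent_half_space V K d : closed V -> V° !=set0 ->
  V d -> d != 0 -> C1_hypersurface (frontier V `\ 0) ->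
  closed K -> convex_set K -> V `<=` K ->
  (forall v (a : R), 0 < a -> V v -> V (a *: v)) ->
  (forall e w, 0 < e :> R -> V (d + e *: w) -> K w) ->
  ~ V° d -> exists2 u, u != 0 & forall x, dot u x <= 0 -> K x.
Proof.
move=> Vcl [z Vz] Vd d0 VC1 Kcl Kcvx VK VZ VdK ndV.
have [|U [f [Uo Ud fC1 df0 Uf]]] := VC1 d.
  by split; [split=> //; exact: subset_closure|exact/eqP].
have fV y : U y -> f y = 0 -> V y.
  move=> Uy fy; have : ([set y | f y = 0] `&` U) y by [].
  by rewrite -Uf => -[[[/Vcl]]].
have fd0 : f d = 0.
  have : ((frontier V `\ 0) `&` U) d.
    by split=> //; split; [split=> //; exact: subset_closure|exact/eqP].
  by rewrite Uf => -[].
have [fdiff _] := fC1 d Ud.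
have fcont y : U y -> {for y, continuous f}.
  by move=> /fC1[/differentiable_continuous].
have [w dw] := df0 d Ud.
have kerK h : 'd f d h = 0 -> K h.
  move=> dh; apply: closed_approx => // e e0.
  have D0 : 0 < `|w| + 1 by rewrite ltr_wpDl.
  have delta0 : 0 < e / (`|w| + 1) by rewrite divr_gt0.
  have [a [s [a0 sd Us fs]]] :=
    diff_zero_near_tangent Uo Ud fcont fdiff fd0 dw dh delta0.
  exists (h + s *: w); first by apply: VdK a0 _; exact: fV.
  rewrite opprD addNKr normrN normrZ (le_lt_trans (ler_wpM2r _ sd))//.
  by rewrite mulrAC ltr_pdivrMr// ltr_pM2l// ltrDl.
(* A set with interior points is not contained in the kernel of a nonzero functional: if [z] is in
   the kernel, a small move along [w] leaves it. *)
have [v0 Vv0 dv0] : exists2 v, V v & 'd f d v != 0.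
  have [dz|] := eqVneq ('d f d z) 0; last by exists z => //; exact: interior_subset.
  have [e e0 Vzw] := interior_segment w Vz.
  by exists (z + e *: w) => //; rewrite linearD linearZ dz add0r mulf_neq0// gt_eqF.
pose c := 'd f d v0.
(* The factor [- c] orients the gradient so that [dot u x <= 0] says that [x] is on the side of
   [v0], that is [x - a *: v0] is in the kernel for some [a >= 0]. *)
pose u := - c *: (\row_j 'd f d (delta_mx 0 j) : 'rV[R]_m).
have dotu x : dot u x = - (c * 'd f d x).
  rewrite linear_dot /dot -mulNr mulr_sumr.
  by apply: eq_bigr => j _; rewrite !mxE mulrA.
exists u.
  apply: contraNneq dv0 => u0; rewrite -sqrf_eq0 expr2 -oppr_eq0 -dotu u0.
  by rewrite /dot big1// => j _; rewrite mxE mul0r.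
move=> x; rewrite dotu oppr_le0 => cx.
pose a := 'd f d x / c.
have a0 : 0 <= a.
  rewrite (_ : a = c * 'd f d x / c ^+ 2); first by rewrite divr_ge0// sqr_ge0.
  by rewrite /a; field.
have ac : a *: (c : R^o) = 'd f d x by exact: divfK.
(* [x] is the midpoint of twice its kernel part and twice [a *: v0], both of which are in [K]. *)
rewrite -(subrK (a *: v0) x); apply: convex_set_mid Kcvx _ _.
  by apply: kerK; rewrite linearZ/= linearD linearN linearZ/= ac subrr scaler0.
rewrite scalerA; move: a0; rewrite le0r => /orP[/eqP ->|a0].
  by rewrite mulr0 scale0r; apply: kerK; rewrite linear0.
by apply/VK/VZ => //; rewrite mulr_gt0.
Qed.

End EuclideanSpace.

Unset Implicit Arguments.
Set Strict Implicit.

Theorem proposition3p31 (R : realType) (n : nat) (n_ge1 : (1 <= n)%N)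
    (C : set 'rV[R]_n.+1) (p : 'rV[R]_n.+1)
    (C_body : convex_body C) (C_unbounded : ~ bounded_set C) (Cp : C p)
    (cone_nondeg : nondegenerate_cone (asymptotic_cone C p))
    (cone_vertex : is_vertex (asymptotic_cone C p) 0)
    (cone_C1 : C1_hypersurface (frontier (asymptotic_cone C p) `\ 0))
    (K : set 'rV[R]_n.+1) (K_cyl : asymptotic_cylinder C K) :
  K = setT \/ closed_half_space K.
Proof.
have [Ccl Ccvx _] := C_body; have [Kcl Kcvx _ _] := K_cyl.
have [d [Vd d0 VK Kd]] := asymptotic_cylinder_cone Ccl Ccvx Cp K_cyl.
have feasible (e : R) w : 0 < e -> asymptotic_cone C p (d + e *: w) -> K w.
  move=> e0 Vdw; have ei : 0 < e^-1 by rewrite invr_gt0.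
  (* This writes [w] as a point of the cone minus a positive multiple of [d]; both summands,
     doubled, lie in [K]. *)
  have -> : w = e^-1 *: (d + e *: w) - e^-1 *: d.
    by rewrite scalerDr scalerA mulVf ?gt_eqF// scale1r addrC addKr.
  apply: convex_set_mid Kcvx _ _.
    by rewrite scalerA; apply/VK/asymptotic_coneZ => //; rewrite mulr_gt0.
  by rewrite scalerN scalerA; apply: Kd; rewrite mulr_gt0.
have [Vd'|ndV] := pselect ((asymptotic_cone C p)° d).
  left; apply/seteqP; split=> // w _.
  by have [e e0] := interior_segment w Vd'; exact: feasible.
have [u u0 uK] := tangent_half_space (closed_asymptotic_cone Ccl) cone_nondeg
  Vd d0 cone_C1 Kcl Kcvx VK (fun v a => @asymptotic_coneZ _ _ _ _ v a) feasible ndV.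
exact: half_space_sup u0 Kcl Kcvx uK.
Qed.
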